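(* Let $f\in C^3(\mathbb{R})$, $y(t,\cdot)\in C^3(\mathbb{R})$ and $p(t,\cdot)\in C^4(\mathbb{R})$, where $y$ is the exact solution of the conservation law $\partial_t y+\partial_x f(y)=0$ and $p$ is the exact solution of the adjoint equation $\partial_t p+f'(y)\,\partial_x p=0$. Then the adjoint WENO3 scheme $$p_j'(t)=\frac{1}{\Delta x}\sum_{i=-2}^{2}\partial_{y_j}L_{i,j}(\boldsymbol{y}(t))\,p_{j+i}(t),\qquad j=1,\dots,N,$$ is adjoint consistent of order three, i.e. the residual-type local spatial errors $$r_j(t)=\partial_t p(t,x_j)-\frac{1}{\Delta x}\sum_{i=-2}^{2}\partial_{y_j}L_{i,j}(\boldsymbol{y}(t))\,p(t,x_{j+i}),$$ in which the coefficients $\partial_{y_j}L_{i,j}$ are evaluated at the exact values $y_k=y(t,x_k)$, satisfy $r_j(t)=\mathcal{O}(\Delta x^3)$ as $\Delta x\to 0$.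
   Context: Setting. $f:\mathbb{R}\to\mathbb{R}$ is a convex flux function. $y=y(t,x)$ is the (entropy) solution of the scalar conservation law $\partial_t y+\partial_x f(y)=0$ on $(0,T]\times\mathbb{R}$ with initial data $y(0,\cdot)=u_0$; it has compact support contained in $[a,b]$ for the whole interval $[0,T]$. $p=p(t,x)$ is the solution of $\partial_t p+f'(y)\partial_x p=0$ on $(0,T]\times\mathbb{R}$ with end data $p(T,\cdot)=p^T$. Grid. $[a,b]$ is divided into $N$ cells $[x_{j-1/2},x_{j+1/2}]$ of equal size $\Delta x=(b-a)/N$ with midpoints $x_j$, $j=1,\dots,N$; as many further points $x_j=x_1+(j-1)\Delta x$ outside $[a,b]$ as needed are used. Flux splitting. $f^{\pm}(y)=\tfrac12(f(y)\pm\alpha y)$ with the constant $\alpha=\max_u|f'(u)|$, the maximum being over the values $u$ taken by the solution $y$; $\alpha$ is treated as a constant when differentiating. WENO3 weights. Fix $\varepsilon$ with $0<\varepsilon\ll1$ (independent of $\Delta x$). Set $\gamma_1^+=\gamma_2^-=1/3$ and $\gamma_1^-=\gamma_2^+=2/3$. For a stencil $\{x_{j-1},x_j,x_{j+1}\}$ with values $y_{j-1},y_j,y_{j+1}$ define $$\beta_1^\pm=(f^\pm(y_j)-f^\pm(y_{j-1}))^2,\quad \beta_2^\pm=(f^\pm(y_{j+1})-f^\pm(y_j))^2,\quad \tilde\omega_m^\pm=\frac{\gamma_m^\pm}{(\varepsilon+\beta_m^\pm)^2},\quad \omega_m^\pm=\frac{\tilde\omega_m^\pm}{\tilde\omega_1^\pm+\tilde\omega_2^\pm},\quad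 m=1,2.$$ Numerical fluxes (functions of $(y_{j-1},y_j,y_{j+1})$, with weights of the stencil $\{x_{j-1},x_j,x_{j+1}\}$): $$\hat f^+_{j+1/2}=\omega_1^+\left(-\tfrac12 f^+(y_{j-1})+\tfrac32 f^+(y_j)\right)+\omega_2^+\left(\tfrac12 f^+(y_j)+\tfrac12 f^+(y_{j+1})\right),$$ $$\hat f^-_{j-1/2}=\omega_2^-\left(-\tfrac12 f^-(y_{j+1})+\tfrac32 f^-(y_j)\right)+\omega_1^-\left(\tfrac12 f^-(y_j)+\tfrac12 f^-(y_{j-1})\right).$$ The index of a flux determines its arguments by shifting, e.g. $\hat f^+_{j+3/2}=\hat f^+_{j+3/2}(y_j,y_{j+1},y_{j+2})$ and $\hat f^-_{j-3/2}=\hat f^-_{j-3/2}(y_{j-2},y_{j-1},y_j)$. Coefficients of the adjoint scheme: $$L_{-2,j}=\hat f^-_{j-3/2},\qquad L_{-1,j}=\hat f^+_{j-1/2}+\hat f^-_{j-1/2}-\hat f^-_{j-3/2},$$ $$L_{0,j}=\hat f^+_{j+1/2}+\hat f^-_{j+1/2}-\hat f^+_{j-1/2}-\hat f^-_{j-1/2},$$ $$L_{1,j}=\hat f^+_{j+3/2}-\hat f^+_{j+1/2}-\hat f^-_{j+1/2},\qquad L_{2,j}=-\hat f^+_{j+3/2}.$$ $\partial_{y_j}$ denotes the partial derivative with respect to the variable $y_j$. (This scheme is the componentwise form of $\boldsymbol p'(t)=\nabla_{\boldsymbol y}F_{\Delta x}(\boldsymbol y(t))^{\sf T}\boldsymbol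 p(t)$, where $(F_{\Delta x}(\boldsymbol y))_j=\frac1{\Delta x}(\hat f_{j+1/2}-\hat f_{j-1/2})$ and $\hat f_{j+1/2}=\hat f^+_{j+1/2}+\hat f^-_{j+1/2}$.) Convention. $\mathcal{O}(\Delta x^q)$ is for $\Delta x\to0$ at fixed $t$ with $\varepsilon$ (and $f,y,p,\alpha,a,b$) fixed; the implied constant does not depend on $\Delta x$ or $j$. *)

(* Defs.v *)
From mathcomp Require Export all_boot all_order all_algebra.
From mathcomp Require Export all_classical all_reals all_analysis.
Set Implicit Arguments.
Unset Strict Implicit.
Unset Printing Implicit Defensive.
Import Order.TTheory GRing.Theory Num.Theory.
Import numFieldNormedType.Exports.
Local Open Scope classical_set_scope.
Local Open Scope ring_scope.

Definition is_Ck (R : realType) (k : nat) (g : R -> R) : Prop :=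
  (forall (i : nat) (x : R), (i < k)%N -> derivable (derive1n i g) x 1) /\
  continuous (derive1n k g).

(* Functions of [(s, x)] are curried, time first.  Only their values for
   [s] in [[0, T]] are meaningful. *)

Definition entropy_test_function (R : realType) (T : R) (phi : R -> R -> R) :
    Prop :=
  [/\ forall s x, 0 <= phi s x,
      forall s x, derivable (phi ^~ x) s 1 /\ derivable (phi s) x 1,
      continuous (fun z : R * R => derive1 (phi ^~ z.2) z.1),
      continuous (fun z : R * R => derive1 (phi z.1) z.2)
    & exists K : set (R * R),
        [/\ compact K, K `<=` `]0, T[%classic `*` setT
          & forall s x, ~ K (s, x) -> phi s x = 0]].

(* Bounded Kruzhkov entropy solution of [y_t + f(y)_x = 0, y(0, .) = u0] in
   C([0, T]; L^1(R)); the time continuity is what gives a meaning to the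
   solution at a fixed time. *)
Record entropy_solution (R : realType) (f : R -> R) (T : R) (u0 : R -> R)
    (y : R -> R -> R) : Prop := {
  entropy_measurable :
    measurable_fun (`[0, T]%classic `*` setT) (fun z : R * R => y z.1 z.2) ;
  entropy_bounded :
    exists M : R, forall s x, 0 <= s <= T -> `|y s x| <= M ;
  entropy_initial : forall x, y 0 x = u0 x ;
  entropy_time_continuous : forall s0, 0 <= s0 <= T ->
    (\int[lebesgue_measure]_(x in [set: R]) `|y s x - y s0 x|%:E)%E
      @[s --> within `[0, T]%classic (nbhs s0)] --> 0%E ;
  entropy_inequality : forall (k : R) (phi : R -> R -> R),
    entropy_test_function T phi ->
    (0 <= \int[lebesgue_measure \x lebesgue_measure]_(z in
             `]0%R, T[%classic `*` [set: R])
           (`|y z.1 z.2 - k| * derive1 (phi ^~ z.2) z.1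
            + Num.sg (y z.1 z.2 - k) * (f (y z.1 z.2) - f k)
              * derive1 (phi z.1) z.2)%:E)%E }.

(* Time derivative at a point of the time domain [(0, T]]: the usual
   derivative for [s < T], the left derivative for [s = T]. *)
Definition time_quotient (R : realType) (p : R -> R -> R) (s x r : R) : R :=
  (p r x - p s x) / (r - s).

Definition time_derivable (R : realType) (T : R) (p : R -> R -> R)
    (s x : R) : Prop :=
  cvg (time_quotient p s x r @[r --> within `]0, T]%classic s^']).

Definition time_derivative (R : realType) (T : R) (p : R -> R -> R)
    (s x : R) : R :=
  lim (time_quotient p s x r @[r --> within `]0, T]%classic s^']).

Record adjoint_solution (R : realType) (f : R -> R) (T : R)
    (y : R -> R -> R) (pT : R -> R) (p : R -> R -> R) : Prop := {
  adjoint_final : forall x, p T x = pT x ;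
  adjoint_time_derivable : forall s x, 0 < s <= T -> time_derivable T p s x ;
  adjoint_space_derivable : forall s x, 0 < s <= T -> derivable (p s) x 1 ;
  adjoint_equation : forall s x, 0 < s <= T ->
    time_derivative T p s x + derive1 f (y s x) * derive1 (p s) x = 0 }.

Definition is_max_speed (R : realType) (f : R -> R) (T : R)
    (y : R -> R -> R) (alpha : R) : Prop :=
  let speeds := [set `|derive1 f (y z.1 z.2)| | z in
                 `[0, T]%classic `*` [set: R]] in
  speeds alpha /\ ubound speeds alpha.

Section Weno3.
Variables (R : realType) (f : R -> R) (alpha eps : R).

Definition flux_plus (u : R) : R := 2^-1 * (f u + alpha * u).
Definition flux_minus (u : R) : R := 2^-1 * (f u - alpha * u).

(* Below [g] is one of the split fluxes and [(ul, uc, ur)] are the values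
   [(y_{j-1}, y_j, y_{j+1})] on the stencil. *)
Definition beta1 (g : R -> R) (ul uc ur : R) : R := (g uc - g ul) ^+ 2.
Definition beta2 (g : R -> R) (ul uc ur : R) : R := (g ur - g uc) ^+ 2.

Definition weight (gamma beta : R) : R := gamma / (eps + beta) ^+ 2.

Definition omega1 (gamma1 gamma2 : R) (g : R -> R) (ul uc ur : R) : R :=
  weight gamma1 (beta1 g ul uc ur) /
  (weight gamma1 (beta1 g ul uc ur) + weight gamma2 (beta2 g ul uc ur)).
Definition omega2 (gamma1 gamma2 : R) (g : R -> R) (ul uc ur : R) : R :=
  weight gamma2 (beta2 g ul uc ur) /
  (weight gamma1 (beta1 g ul uc ur) + weight gamma2 (beta2 g ul uc ur)).

Definition omega1_plus := omega1 (1 / 3) (2 / 3) flux_plus.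
Definition omega2_plus := omega2 (1 / 3) (2 / 3) flux_plus.
Definition omega1_minus := omega1 (2 / 3) (1 / 3) flux_minus.
Definition omega2_minus := omega2 (2 / 3) (1 / 3) flux_minus.

Definition num_flux_plus (ul uc ur : R) : R :=
  omega1_plus ul uc ur * (- (1 / 2) * flux_plus ul + 3 / 2 * flux_plus uc)
  + omega2_plus ul uc ur * (1 / 2 * flux_plus uc + 1 / 2 * flux_plus ur).
Definition num_flux_minus (ul uc ur : R) : R :=
  omega2_minus ul uc ur * (- (1 / 2) * flux_minus ur + 3 / 2 * flux_minus uc)
  + omega1_minus ul uc ur * (1 / 2 * flux_minus uc + 1 / 2 * flux_minus ul).

(* Grid functions are indexed by [int].  [fhat_plus j] and [fhat_minus j] are
   both attached to the interface j+1/2, so that the stencil of the latter is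
   centred at [j + 1]. *)
Definition fhat_plus (j : int) (Y : int -> R) : R :=
  num_flux_plus (Y (j - 1)) (Y j) (Y (j + 1)).
Definition fhat_minus (j : int) (Y : int -> R) : R :=
  num_flux_minus (Y j) (Y (j + 1)) (Y (j + 2)).

(* [adjoint_L i j] is L_{i,j}; only -2 <= i <= 2 is used. *)
Definition adjoint_L (i j : int) (Y : int -> R) : R :=
  if i == -2 then fhat_minus (j - 2) Y
  else if i == -1 then
    fhat_plus (j - 1) Y + fhat_minus (j - 1) Y - fhat_minus (j - 2) Y
  else if i == 0 then
    fhat_plus j Y + fhat_minus j Y - fhat_plus (j - 1) Y - fhat_minus (j - 1) Y
  else if i == 1 then
    fhat_plus (j + 1) Y - fhat_plus j Y - fhat_minus j Y
  else if i == 2 then - fhat_plus (j + 1) Y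
  else 0.

Definition partial (j : int) (F : (int -> R) -> R) (Y : int -> R) : R :=
  derive1 (fun v : R => F [eta Y with j |-> v]) (Y j).

Definition adjoint_rhs (dx : R) (Y P : int -> R) (j : int) : R :=
  dx^-1 * \sum_(i <- [:: -2; -1; 0; 1; 2] : seq int)
            partial j (adjoint_L i j) Y * P (j + i).

End Weno3.

Definition mesh_size (R : realType) (a b : R) (N : nat) : R := (b - a) / N%:R.

(* Midpoint of the [j]-th cell for 1 <= j <= N, extended outside [[a, b]]. *)
Definition grid_point (R : realType) (a b : R) (N : nat) (j : int) : R :=
  a + (j%:~R - 1 / 2) * mesh_size a b N.

Definition adjoint_residual (R : realType) (f : R -> R) (alpha eps T a b : R)
    (y p : R -> R -> R) (N : nat) (t : R) (j : int) : R :=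
  time_derivative T p t (grid_point a b N j)
  - adjoint_rhs f alpha eps (mesh_size a b N)
      (fun k => y t (grid_point a b N k)) (fun k => p t (grid_point a b N k)) j.

(* Main.v *)
(** Each numerical flux is [g_c + Phi(d1, d2) / 2], where [d1] and [d2] are the
    two increments of the split flux [g] over the stencil and
    [Phi(d1, d2) = omega1 d1 + omega2 d2].  The partial derivatives of [Phi]
    differ from the linear weights by [O((|d1| + |d2|) |d2 - d1|)], which is
    [O(dx^3)] along a smooth solution.  After a summation by parts in [p] these
    derivatives only multiply increments of [p], which are [O(dx)]; so up to
    [O(dx^4)] the weights may be replaced by the linear ones, for which the
    scheme is a third-order upwind difference of [p].  The minus part of the
    splitting is the plus part with the direction of space reversed. *)
Require Import Defs.
From mathcomp Require Import ring lra.
Import Order.TTheory GRing.Theory Num.Theory.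
Import numFieldNormedType.Exports.
Local Open Scope classical_set_scope.
Local Open Scope ring_scope.

Set Implicit Arguments.
Unset Strict Implicit.
Unset Printing Implicit Defensive.

(** * Mean value and Taylor bounds on a segment *)

Lemma mean_value_le (R : realType) (q : R -> R) (x z M : R) :
  (forall w : R, derivable q w 1) ->
  (forall w, Num.min x z <= w <= Num.max x z -> `|derive1 q w| <= M) ->
  `|q z - q x| <= M * `|z - x|.
Proof.
move=> dq hM.
have D (w : R) : is_derive w 1 q (derive1 q w).
  by rewrite derive1E; apply: derivableP.
have cq : continuous q.
  by move=> w; apply/differentiable_continuous/derivable1_diffP.
wlog xz : x z hM / x <= z => [H|].
  have [xz|/ltW zx] := leP x z; first exact: H.
  by rewrite distrC (distrC z); apply: H => // w; rewrite minC maxC; apply: hM.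
have [c + ->] := MVT_segment xz (fun w _ => D w) (continuous_subspaceT cq).
rewrite in_itv /= => xcz; rewrite normrM ler_wpM2r//; apply: hM.
by rewrite min_l ?max_r.
Qed.

Lemma segment_bounded (R : realType) (g : R -> R) (c d : R) :
  continuous g -> exists M : R, forall x, c <= x <= d -> `|g x| <= M.
Proof.
move=> cg; have [cd|dc] := leP c d; last first.
  exists 0 => x /andP[cx xd].
  by have := lt_le_trans dc (le_trans cx xd); rewrite ltxx.
have cn : {within `[c, d], continuous (fun x => `|g x|)}.
  apply: continuous_subspaceT => x; apply: continuous_comp; first exact: cg.
  exact: norm_continuous.
have [m _ hm] := EVT_max cd cn.
by exists `|g m| => x xcd; apply: hm; rewrite in_itv.
Qed.

(** Induction on [n] by the mean value inequality: the remainder vanishes at [x], and its derivative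
    is the remainder of [derive1 g] one order lower. The factor [1/n!] is given up, which only
    affects constants. *)
Lemma taylor_le (R : realType) (n : nat) (g : R -> R) (c d M x z : R) :
  (forall (i : nat) (w : R), (i < n)%N -> derivable (derive1n i g) w 1) ->
  (forall w, c <= w <= d -> `|derive1n n g w| <= M) ->
  c <= x <= d -> c <= z <= d ->
  `|g z - \sum_(i < n) derive1n i g x / i`!%:R * (z - x) ^+ i|
     <= M * `|z - x| ^+ n.
Proof.
elim: n g z => [|n IH] g z dg hM hx hz.
  by rewrite big_ord0 subr0 expr0 mulr1; apply: hM.
pose r w := g w - \sum_(i < n.+1) derive1n i g x / i`!%:R * (w - x) ^+ i.
pose r' w := derive1 g w -
  \sum_(i < n) derive1n i (derive1 g) x / i`!%:R * (w - x) ^+ i.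
have rE (w : R) : is_derive w 1 r (r' w).
  have h (i : 'I_n.+1) : is_derive w 1
      (fun v : R => derive1n i g x / i`!%:R * (v - x) ^+ i)
      (derive1n i g x / i`!%:R * (i%:R * (w - x) ^+ i.-1)).
    have d1 : is_derive w 1 (fun v : R => v - x) 1.
      apply: (is_derive_eq
        (is_deriveB (is_derive_id _ _) (is_derive_cst x _ _))).
      by rewrite subr0.
    have := is_deriveZ (derive1n i g x / i`!%:R) (is_deriveX i d1).
    rewrite exprfctE => /is_derive_eq; apply.
    by rewrite /GRing.scale /= mulr1.
  have dgw : is_derive w 1 g (derive1 g w).
    by rewrite derive1E; apply: derivableP; apply: (dg 0%N).
  have := is_deriveB dgw (is_derive_sum h).
  rewrite (_ : g - _ = r); last first.
    by apply/funext => v; rewrite /r !fctE fct_sumE.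
  move/is_derive_eq; apply; rewrite /r'; congr (_ - _).
  rewrite big_ord_recl /= mul0r mulr0 add0r; apply: eq_bigr => i _.
  rewrite -derive1Sn /bump /= add1n add0n factS natrM mulrA; congr (_ * _).
  rewrite invfM -mulrA; congr (_ * _).
  by rewrite mulrC mulrA mulfV ?mul1r// pnatr_eq0.
have dr (w : R) : derivable r w 1 by have [] := rE w.
have rx : r x = 0.
  rewrite /r big_ord_recl big1 => [|i _]; last by rewrite subrr expr0n mulr0.
  by rewrite expr0 /= fact0 invr1 !mulr1 addr0 subrr.
have : `|r z - r x| <= (M * `|z - x| ^+ n) * `|z - x|.
  apply: mean_value_le => // w /andP[w1 w2].
  have [/andP[cx xd] /andP[cz zd]] := (hx, hz).
  have wcd : c <= w <= d.
    rewrite (le_trans _ w1) ?le_min ?cx//.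
    by rewrite (le_trans w2)// ge_max xd.
  (* As [w] lies between [x] and [z], the inductive bound at [w] is at most its value at [z]. *)
  have wz : `|w - x| <= `|z - x|.
    have [xz|/ltW zx] := leP x z.
      move: w1 w2; rewrite (min_l xz) (max_r xz) => w1 w2.
      by rewrite !ger0_norm ?subr_ge0 ?lerD2r.
    move: w1 w2; rewrite (min_r zx) (max_l zx) => w1 w2.
    by rewrite !ler0_norm ?subr_le0// lerN2 lerD2r.
  rewrite derive1E (@derive_val _ _ _ _ _ _ _ (rE w)).
  apply: (le_trans (IH (derive1 g) w _ _ hx wcd)).
  - by move=> i v i_n; rewrite -derive1Sn; apply: dg.
  - by move=> v; rewrite -derive1Sn; apply: hM.
  rewrite ler_wpM2l ?lerXn2r// ?nnegrE//.
  exact: le_trans (hM x hx).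
by rewrite rx subr0 -mulrA -exprSr.
Qed.

Lemma is_deriveV (R : realType) (g : R -> R) (s dg : R) : g s != 0 ->
  is_derive s 1 g dg -> is_derive s 1 (fun r => (g r)^-1) (- g s ^- 2 * dg).
Proof.
move=> gs0 [hg <-]; apply: DeriveDef; first exact: derivableV.
by rewrite deriveV.
Qed.

(** * Nonlinear weights and their distance to the linear ones *)

Section WenoSlope.
Variables (R : realType) (eps : R).
Hypothesis eps_gt0 : 0 < eps.

(** For increments [u], [v] and linear weights 1/3, 2/3, this is the sum of the two unnormalised
    weights times [3 (eps + u^2)^2 (eps + v^2)^2]; hence [weno_weight] is [omega2]. *)
Definition weno_den (u v : R) : R :=
  (eps + v ^+ 2) ^+ 2 + 2 * (eps + u ^+ 2) ^+ 2.

Definition weno_weight (u v : R) : R := 2 * (eps + u ^+ 2) ^+ 2 / weno_den u v.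

(* [omega1 u + omega2 v] for the linear weights 1/3 and 2/3, after clearing the
   denominators of the nonlinear weights. *)
Definition weno_slope (u v : R) : R := u + weno_weight u v * (v - u).

(** Together with [weno_slope_dr], the partial derivatives of [weno_slope]; the last term of each is
    the derivative of the weight times [v - u]. *)
Definition weno_slope_dl (u v : R) : R :=
  1 - weno_weight u v
  + 8 * (eps + u ^+ 2) * (eps + v ^+ 2) ^+ 2 / weno_den u v ^+ 2
    * (u * (v - u)).

Definition weno_slope_dr (u v : R) : R :=
  weno_weight u v
  - 8 * (eps + u ^+ 2) ^+ 2 * (eps + v ^+ 2) / weno_den u v ^+ 2
    * (v * (v - u)).

Lemma weno_den_gt0 (u v : R) : 0 < weno_den u v.
Proof.
have pos (w : R) : 0 < (eps + w ^+ 2) ^+ 2.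
  by rewrite exprn_gt0// ltr_wpDr// sqr_ge0.
exact: addr_gt0 (pos v) (mulr_gt0 (ltr0Sn _ 1) (pos u)).
Qed.

Lemma is_derive_eps_sqr (a : R -> R) (s da : R) :
  is_derive s 1 a da ->
  is_derive s 1 (fun r => (eps + a r ^+ 2) ^+ 2)
    (4 * (eps + a s ^+ 2) * (a s * da)).
Proof.
move=> ha.
have h1 : is_derive s 1 (fun r => eps + a r ^+ 2) (2 * a s * da).
  apply: (is_derive_eq (is_deriveD (is_derive_cst eps _ _) (is_deriveX 2 ha))).
  by rewrite /GRing.scale /= expr1 add0r.
apply: (is_derive_eq (is_deriveX 2 h1)).
by rewrite /GRing.scale /= expr1; ring.
Qed.

(** Stated along curves, so that the moving grid value may enter either increment or both. *)
Lemma is_derive_weno_slope (a b : R -> R) (s da db : R) :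
  is_derive s 1 a da -> is_derive s 1 b db ->
  is_derive s 1 (fun r => weno_slope (a r) (b r))
    (weno_slope_dl (a s) (b s) * da + weno_slope_dr (a s) (b s) * db).
Proof.
move=> ha hb.
have hA : is_derive s 1 (fun r => 2 * (eps + a r ^+ 2) ^+ 2)
    (2 * (4 * (eps + a s ^+ 2) * (a s * da))) :=
  is_deriveZ 2 (is_derive_eps_sqr ha).
have hD : is_derive s 1 (fun r => weno_den (a r) (b r))
    (4 * (eps + b s ^+ 2) * (b s * db) +
     2 * (4 * (eps + a s ^+ 2) * (a s * da))) :=
  is_deriveD (is_derive_eps_sqr hb) hA.
have dn0 : weno_den (a s) (b s) != 0 by rewrite gt_eqF ?weno_den_gt0.
have hV := is_deriveV (g := fun r => weno_den (a r) (b r)) dn0 hD.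
apply: (is_derive_eq
  (is_deriveD ha (is_deriveM (is_deriveM hA hV) (is_deriveB hb ha)))).
rewrite /weno_slope_dl /weno_slope_dr /weno_weight /GRing.scale /= !fctE.
by move: dn0; rewrite /weno_den => dn0; field.
Qed.

(** With [A = eps + u^2], [B = eps + v^2] and [D] the denominator, the deviation is
    [2/3 (A^2 - B^2) / D], and [A - B = (u + v) (u - v)]. *)
Lemma weno_weight_le (u v : R) :
  `|weno_weight u v - 2 / 3| <= eps^-1 * ((`|u| + `|v|) * `|v - u|).
Proof.
have den0 := weno_den_gt0 u v.
pose c := (eps + u ^+ 2 + (eps + v ^+ 2)) / weno_den u v.
have c0 : 0 <= c.
  by rewrite divr_ge0 ?(ltW den0)// !addr_ge0 ?sqr_ge0// ltW.
have -> : weno_weight u v - 2 / 3 = c * (2 / 3 * ((u + v) * (u - v))).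
  rewrite /c /weno_weight; move/lt0r_neq0: den0; rewrite /weno_den => den0.
  by field.
rewrite normrM (ger0_norm c0); apply: ler_pM => //.
  (* Here [c <= eps^-1], since [eps (A + B) <= A^2 + B^2 <= D]. *)
  rewrite ler_pdivrMr// mulrC ler_pdivlMr//.
  rewrite /weno_den.
  move: (u ^+ 2) (v ^+ 2) (sqr_ge0 u) (sqr_ge0 v) => U V U0 V0.
  by have := eps_gt0; nra.
have h23 : 0 <= (2 / 3 : R) <= 1 by apply/andP; split; lra.
rewrite normrM [`|2 / 3|]ger0_norm; last by case/andP: h23.
rewrite normrM (distrC u).
apply: (@le_trans _ _ (1 * (`|u + v| * `|v - u|))).
  by rewrite ler_wpM2r ?mulr_ge0//; case/andP: h23.
by rewrite mul1r ler_wpM2r// ler_normD.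
Qed.

Lemma weno_den_sqr_ge (u v : R) :
  8 * (eps + u ^+ 2) ^+ 2 * (eps + v ^+ 2) ^+ 2 <= weno_den u v ^+ 2.
Proof.
(* AM-GM for the two terms of the denominator. *)
have := sqr_ge0 ((eps + v ^+ 2) ^+ 2 - 2 * (eps + u ^+ 2) ^+ 2).
rewrite /weno_den; set A := (eps + u ^+ 2) ^+ 2.
by set B := (eps + v ^+ 2) ^+ 2; nra.
Qed.

(** One factor [eps] is traded for [A], after which the bound on [D ^+ 2] applies. Keeping [A] and
    [B] abstract serves both partial derivatives, which exchange their roles. *)
Lemma weno_corr_le (A B D : R) : eps <= A -> 0 < B -> 0 < D ->
  8 * A ^+ 2 * B ^+ 2 <= D ^+ 2 -> 0 <= 8 * A * B ^+ 2 / D ^+ 2 <= eps^-1.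
Proof.
move=> epsA B0 D0 hD.
have A0 : 0 < A by exact: lt_le_trans epsA.
have D2 : 0 < D ^+ 2 by rewrite exprn_gt0.
apply/andP; split.
  by rewrite divr_ge0 ?(ltW D2)// mulr_ge0 ?sqr_ge0// mulr_ge0// ltW.
rewrite ler_pdivrMr// [leRHS]mulrC ler_pdivlMr//; apply: le_trans hD.
rewrite -subr_ge0 (_ : _ - _ = 8 * A * B ^+ 2 * (A - eps)); last by ring.
by rewrite mulr_ge0 ?subr_ge0// mulr_ge0 ?sqr_ge0// mulr_ge0// ltW.
Qed.

(** [W] is the deviation of the weight and [c * (w * d)] comes from differentiating it; each
    contributes one [eps^-1]. *)
Lemma weno_slope_partial_le (W c w d e : R) : 0 <= c <= eps^-1 ->
  `|W| <= eps^-1 * (e * `|d|) -> `|w| <= e ->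
  `|W + c * (w * d)| <= 2 / eps * (e * `|d|).
Proof.
move=> /andP[c0 c1] hW we; rewrite (le_trans (ler_normD _ _))//.
rewrite (_ : 2 / eps = eps^-1 + eps^-1) ?mulrDl; last by ring.
by rewrite lerD// normrM (ger0_norm c0) ler_pM// normrM ler_wpM2r.
Qed.

Lemma weno_slope_dl_le (u v : R) :
  `|weno_slope_dl u v - 1 / 3| <= 2 / eps * ((`|u| + `|v|) * `|v - u|).
Proof.
have c1 := weno_corr_le _ _ (weno_den_gt0 u v) (weno_den_sqr_ge u v).
have -> : weno_slope_dl u v - 1 / 3 = - (weno_weight u v - 2 / 3) +
    8 * (eps + u ^+ 2) * (eps + v ^+ 2) ^+ 2 / weno_den u v ^+ 2
      * (u * (v - u)).
  by rewrite /weno_slope_dl; field; rewrite gt_eqF// weno_den_gt0.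
apply: weno_slope_partial_le; last by rewrite lerDl.
  by apply: c1; rewrite ?lerDl ?ltr_wpDr ?sqr_ge0.
by rewrite normrN; apply: weno_weight_le.
Qed.

Lemma weno_slope_dr_le (u v : R) :
  `|weno_slope_dr u v - 2 / 3| <= 2 / eps * ((`|u| + `|v|) * `|v - u|).
Proof.
have hD : 8 * (eps + v ^+ 2) ^+ 2 * (eps + u ^+ 2) ^+ 2 <= weno_den u v ^+ 2.
  by rewrite mulrAC; apply: weno_den_sqr_ge.
have c1 := weno_corr_le _ _ (weno_den_gt0 u v) hD.
(* The minus sign goes into the factor [- v], leaving a nonnegative coefficient. *)
have -> : weno_slope_dr u v - 2 / 3 = (weno_weight u v - 2 / 3) +
    8 * (eps + v ^+ 2) * (eps + u ^+ 2) ^+ 2 / weno_den u v ^+ 2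
      * (- v * (v - u)).
  by rewrite /weno_slope_dr; field; rewrite gt_eqF// weno_den_gt0.
apply: weno_slope_partial_le; last by rewrite normrN lerDr.
  by apply: c1; rewrite ?lerDl ?ltr_wpDr ?sqr_ge0.
exact: weno_weight_le.
Qed.
End WenoSlope.

(** * Summation by parts: the adjoint scheme as two one-sided stencils *)

Section AdjointStencil.
Variables (R : realType) (f : R -> R) (alpha eps : R).
Hypothesis eps_gt0 : 0 < eps.
Local Notation dl := (weno_slope_dl eps).
Local Notation dr := (weno_slope_dr eps).

Definition weno_value (gl gc gr : R) : R :=
  gc + 1 / 2 * weno_slope eps (gc - gl) (gr - gc).

Lemma is_derive_weno_value (l c r : R -> R) (s l' c' r' : R) :
  is_derive s 1 l l' -> is_derive s 1 c c' -> is_derive s 1 r r' ->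
  is_derive s 1 (fun v => weno_value (l v) (c v) (r v))
    (c' + 1 / 2 * (dl (c s - l s) (r s - c s) * (c' - l')
                   + dr (c s - l s) (r s - c s) * (r' - c'))).
Proof.
move=> hl hc hr.
exact: is_deriveD hc (is_deriveZ (1 / 2)
  (is_derive_weno_slope eps_gt0 (is_deriveB hc hl) (is_deriveB hr hc))).
Qed.

Lemma num_flux_plusE (ul uc ur : R) (g := flux_plus f alpha) :
  num_flux_plus f alpha eps ul uc ur = weno_value (g ul) (g uc) (g ur).
Proof.
rewrite /num_flux_plus /omega1_plus /omega2_plus /omega1 /omega2 /weight.
rewrite /beta1 /beta2 /weno_value /weno_slope /weno_weight.
have := weno_den_gt0 eps_gt0 (g uc - g ul) (g ur - g uc).
rewrite /weno_den -/g => /lt0r_neq0 hD; field.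
by rewrite hD !gt_eqF// ltr_wpDr// sqr_ge0.
Qed.

(** Exchanging the outer values turns the linear weights 2/3, 1/3 into 1/3, 2/3, so the same
    [weno_value] serves both wind directions. *)
Lemma num_flux_minusE (ul uc ur : R) (g := flux_minus f alpha) :
  num_flux_minus f alpha eps ul uc ur = weno_value (g ur) (g uc) (g ul).
Proof.
rewrite /num_flux_minus /omega1_minus /omega2_minus /omega1 /omega2 /weight.
rewrite /beta1 /beta2 /weno_value /weno_slope /weno_weight.
have := weno_den_gt0 eps_gt0 (g uc - g ur) (g ul - g uc).
rewrite /weno_den -/g => /lt0r_neq0 hD; field.
rewrite hD ?andbT !gt_eqF ?ltr_wpDr// ?sqr_ge0//.
Qed.

(* The contribution to the adjoint scheme of the fluxes of one wind direction,
   per unit of the derivative of the split flux at [y_j]; [G] and [P] are the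
   values of the split flux and of [p], indexed relatively to [j]. *)
Definition adjoint_stencil (G P : int -> R) : R :=
  1 / 2 * dr (G (-1) - G (-2)) (G 0 - G (-1)) * (P (-1) - P 0)
  + (1 + 1 / 2 * (dl (G 0 - G (-1)) (G 1 - G 0)
                  - dr (G 0 - G (-1)) (G 1 - G 0)))
    * (P 0 - P 1)
  - 1 / 2 * dl (G 1 - G 0) (G 2 - G 1) * (P 1 - P 2).

Lemma partialE (j : int) (F : (int -> R) -> R) (Y : int -> R) (d : R) :
  is_derive (Y j) 1 (fun v => F [eta Y with j |-> v]) d -> partial j F Y = d.
Proof. by move=> h; rewrite /partial derive1E derive_val. Qed.

(** Three fluxes of each direction depend on [Y j], and each occurs in two consecutive [adjoint_L]
    with opposite signs, hence multiplies an increment of [P]. Reversing space flips these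
    increments, whence the minus sign. *)
Lemma adjoint_rhs_sumE (Y P : int -> R) (j : int)
    (gp := flux_plus f alpha) (gm := flux_minus f alpha) :
  derivable f (Y j) 1 ->
  \sum_(i <- [:: -2; -1; 0; 1; 2] : seq int)
      partial j (adjoint_L f alpha eps i j) Y * P (j + i) =
    derive1 gp (Y j) *
      adjoint_stencil (fun k => gp (Y (j + k))) (fun k => P (j + k))
    - derive1 gm (Y j) *
      adjoint_stencil (fun k => gm (Y (j - k))) (fun k => P (j - k)).
Proof.
move=> df.
have upd0 v : [eta Y with j |-> v] j = v by rewrite /= eqxx.
have upd (c : int) v : c != 0 -> [eta Y with j |-> v] (j + c) = Y (j + c).
  by move=> /negPf c0; rewrite /= -[X in _ == X]addr0 (inj_eq (addrI j)) c0.
have hp : is_derive (Y j) 1 gp (derive1 gp (Y j)).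
  rewrite derive1E; apply: derivableP; apply: derivableZ.
  by apply: derivableD => //; apply: derivableZ.
have hm : is_derive (Y j) 1 gm (derive1 gm (Y j)).
  rewrite derive1E; apply: derivableP; apply: derivableZ.
  by apply: derivableB => //; apply: derivableZ.
have cst (c : R) : is_derive (Y j) 1 (fun _ => c) 0 by exact: is_derive_cst.
have e1 : j - 1 - 1 = j - 2 by ring.
have e2 : j - 1 + 1 = j by ring.
have e3 : j - 1 + 2 = j + 1 by ring.
have e4 : j - 2 + 1 = j - 1 by ring.
have e5 : j - 2 + 2 = j by ring.
have e6 : j + 1 - 1 = j by ring.
have e7 : j + 1 + 1 = j + 2 by ring.
pose yp (c : int) := gp (Y (j + c)); pose ym (c : int) := gm (Y (j + c)).
(* The six fluxes as functions of the moving value [v], all other stencil values being frozen. *)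
have fp1 : (fun v => fhat_plus f alpha eps (j - 1) [eta Y with j |-> v]) =
    (fun v => weno_value (yp (- 2)) (yp (- 1)) (gp v)).
  apply/funext => v; rewrite /fhat_plus num_flux_plusE e1 e2 upd0.
  by rewrite !upd.
have fp2 : (fun v => fhat_plus f alpha eps j [eta Y with j |-> v]) =
    (fun v => weno_value (yp (- 1)) (gp v) (yp 1)).
  by apply/funext => v; rewrite /fhat_plus num_flux_plusE upd0 !upd.
have fp3 : (fun v => fhat_plus f alpha eps (j + 1) [eta Y with j |-> v]) =
    (fun v => weno_value (gp v) (yp 1) (yp 2)).
  apply/funext => v; rewrite /fhat_plus num_flux_plusE e6 e7 upd0.
  by rewrite !upd.
have fm1 : (fun v => fhat_minus f alpha eps (j - 2) [eta Y with j |-> v]) =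
    (fun v => weno_value (gm v) (ym (- 1)) (ym (- 2))).
  apply/funext => v; rewrite /fhat_minus num_flux_minusE e4 e5 upd0.
  by rewrite !upd.
have fm2 : (fun v => fhat_minus f alpha eps (j - 1) [eta Y with j |-> v]) =
    (fun v => weno_value (ym 1) (gm v) (ym (- 1))).
  apply/funext => v; rewrite /fhat_minus num_flux_minusE e2 e3 upd0.
  by rewrite !upd.
have fm3 : (fun v => fhat_minus f alpha eps j [eta Y with j |-> v]) =
    (fun v => weno_value (ym 2) (ym 1) (gm v)).
  by apply/funext => v; rewrite /fhat_minus num_flux_minusE upd0 !upd.
have dp1 := is_derive_weno_value (cst (yp (- 2))) (cst (yp (- 1))) hp.
have dp2 := is_derive_weno_value (cst (yp (- 1))) hp (cst (yp 1)).
have dp3 := is_derive_weno_value hp (cst (yp 1)) (cst (yp 2)).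
have dm1 := is_derive_weno_value hm (cst (ym (- 1))) (cst (ym (- 2))).
have dm2 := is_derive_weno_value (cst (ym 1)) hm (cst (ym (- 1))).
have dm3 := is_derive_weno_value (cst (ym 2)) (cst (ym 1)) hm.
rewrite -fp1 in dp1; rewrite -fp2 in dp2; rewrite -fp3 in dp3.
rewrite -fm1 in dm1; rewrite -fm2 in dm2; rewrite -fm3 in dm3.
rewrite !big_cons big_nil.
(* At a concrete first index [adjoint_L] computes to its signed sum of fluxes, so the derivatives
   above combine directly. *)
rewrite (partialE (F := adjoint_L f alpha eps (-2) j) dm1).
rewrite (partialE (F := adjoint_L f alpha eps (-1) j)
  (is_deriveB (is_deriveD dp1 dm2) dm1)).
rewrite (partialE (F := adjoint_L f alpha eps 0 j)
  (is_deriveB (is_deriveB (is_deriveD dp2 dm3) dp1) dm2)).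
rewrite (partialE (F := adjoint_L f alpha eps 1 j)
  (is_deriveB (is_deriveB dp3 dp2) dm3)).
rewrite (partialE (F := adjoint_L f alpha eps 2 j) (is_deriveN dp3)).
rewrite /adjoint_stencil !opprK subr0 addr0.
rewrite /yp /ym; ring.
Qed.
End AdjointStencil.

(** * Third-order consistency of one stencil *)

Lemma adjoint_stencil_le (R : realType) (eps h M1 M2 P1 P4 q : R)
    (G P : int -> R) : 0 < eps -> 0 <= h ->
  (forall k : int, k \in [:: -2; -1; 0; 1] -> `|G (k + 1) - G k| <= M1 * h) ->
  (forall k : int, k \in [:: -1; 0; 1] ->
     `|(G (k + 1) - G k) - (G k - G (k - 1))| <= M2 * h ^+ 2) ->
  (forall k : int, k \in [:: -1; 0; 1] -> `|P k - P (k + 1)| <= P1 * h) ->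
  `|1 / 3 * P (-1) + 1 / 2 * P 0 - P 1 + 1 / 6 * P 2 + q| <= P4 * h ^+ 4 ->
  `|adjoint_stencil eps G P + q|
    <= (P4 + 8 / eps * (M1 * M2 * P1)) * h ^+ 4.
Proof.
move=> eps0 h0 hG1 hG2 hP hq.
(* Bound on each deviation from a linear weight: two increments of size [M1 * h] and a second
   difference of size [M2 * h ^+ 2]. *)
pose K := 2 / eps * ((M1 * h + M1 * h) * (M2 * h ^+ 2)).
have e2 : 0 <= 2 / eps by rewrite divr_ge0 ?ltW.
have dlK (k : int) : k \in [:: -1; 0; 1] ->
  `|weno_slope_dl eps (G k - G (k - 1)) (G (k + 1) - G k) - 1 / 3| <= K /\
  `|weno_slope_dr eps (G k - G (k - 1)) (G (k + 1) - G k) - 2 / 3| <= K.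
  move=> hk.
  have b1 : `|G (k + 1) - G k| <= M1 * h.
    by apply: hG1; rewrite inE hk orbT.
  have b2 : `|G k - G (k - 1)| <= M1 * h.
    have := hG1 (k - 1); rewrite subrK; apply.
    by move: hk; rewrite !inE => /or3P[] /eqP ->.
  have b3 := hG2 k hk.
  split; [apply: (le_trans (weno_slope_dl_le eps0 _ _))
         |apply: (le_trans (weno_slope_dr_le eps0 _ _))];
    by rewrite ler_wpM2l// ler_pM ?addr_ge0// lerD.
have r1 : `|weno_slope_dr eps (G (-1) - G (-2)) (G 0 - G (-1)) - 2 / 3| <= K :=
  (dlK (-1) isT).2.
have [l0 r0] :
    `|weno_slope_dl eps (G 0 - G (-1)) (G 1 - G 0) - 1 / 3| <= K /\
    `|weno_slope_dr eps (G 0 - G (-1)) (G 1 - G 0) - 2 / 3| <= K := dlK 0 isT.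
have l1 : `|weno_slope_dl eps (G 1 - G 0) (G 2 - G 1) - 1 / 3| <= K :=
  (dlK 1 isT).1.
have p1 : `|P (-1) - P 0| <= P1 * h := hP (-1) isT.
have p0 : `|P 0 - P 1| <= P1 * h := hP 0 isT.
have p2 : `|P 1 - P 2| <= P1 * h := hP 1 isT.
have mulK (u v : R) : `|u| <= K -> `|v| <= P1 * h -> `|u * v| <= K * (P1 * h).
  by move=> hu hv; rewrite normrM ler_pM.
rewrite /adjoint_stencil.
set ql := (X in `|X| <= P4 * _) in hq.
move: r1 l0 r0 l1; set dr1 := weno_slope_dr _ _ _.
set dl0 := weno_slope_dl _ _ _; set dr0 := weno_slope_dr _ _ _.
set dl1 := weno_slope_dl _ _ _ => r1 l0 r0 l1.
(* With the weights frozen at 1/3 and 2/3 the stencil is the linear difference of [P] contained in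
   [ql]; four deviations remain, each with coefficient 1/2. *)
rewrite [X in `|X|](_ : _ = 1 / 2 * ((dr1 - 2 / 3) * (P (-1) - P 0))
    + 1 / 2 * ((dl0 - 1 / 3) * (P 0 - P 1))
    - 1 / 2 * ((dr0 - 2 / 3) * (P 0 - P 1))
    - 1 / 2 * ((dl1 - 1 / 3) * (P 1 - P 2)) + ql); last by rewrite /ql; field.
have := mulK _ _ r1 p1; have := mulK _ _ l0 p0.
have := mulK _ _ r0 p0; have := mulK _ _ l1 p2.
rewrite (_ : (P4 + _) * _ = P4 * h ^+ 4 + 2 * (K * (P1 * h))); last first.
  by rewrite /K; ring.
move: (K * _) (P4 * _) hq => k b; rewrite !ler_norml; lra.
Qed.

(** The constant is uniform over all stencils inside the segment from [c] to [d]. The step [s] may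
    be negative, which covers the minus fluxes. *)
Lemma adjoint_stencil_consistent (R : realType) (eps c d : R)
    (phi p : R -> R) : 0 < eps -> is_Ck 2 phi -> is_Ck 4 p ->
  exists C, forall x s : R, c <= x - 2 * `|s| -> x + 2 * `|s| <= d ->
    `|adjoint_stencil eps (fun k => phi (x + k%:~R * s))
        (fun k => p (x + k%:~R * s)) + s * derive1 p x| <= C * `|s| ^+ 4.
Proof.
move=> eps0 [dphi cphi2] [dp cp4].
have dn (g : R -> R) i : (forall w : R, derivable (derive1n i g) w 1) ->
    continuous (derive1n i g).
  by move=> dg w; apply/differentiable_continuous/derivable1_diffP.
have [M1 hM1] := segment_bounded c d (dn phi 1%N (fun w => dphi 1%N w isT)).
have [M2 hM2] := segment_bounded c d cphi2.
have [P1 hP1] := segment_bounded c d (dn p 1%N (fun w => dp 1%N w isT)).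
have [P4 hP4] := segment_bounded c d cp4.
(* [4 = 1/3 + 1 + 16/6] sums the Taylor remainders of [p] at the nodes [-1], [1], [2]; [2 * M2]
   bounds a second difference by two remainders of the split flux. *)
exists (4 * P4 + 8 / eps * (M1 * (2 * M2) * P1)) => x s cx xd.
have s0 := normr_ge0 s.
have in_cd (k : int) : `|k| <= 2 -> c <= x + k%:~R * s <= d.
  rewrite -(ler_int R) intr_norm => k2.
  have : `|k%:~R * s| <= 2 * `|s| by rewrite normrM ler_wpM2r.
  by rewrite ler_norml => /andP[? ?]; apply/andP; split; lra.
have lip (g : R -> R) M : (forall w : R, derivable g w 1) ->
    (forall w, c <= w <= d -> `|derive1 g w| <= M) ->
    forall k : int, `|k| <= 2 -> `|k + 1| <= 2 ->
    `|g (x + (k + 1)%:~R * s) - g (x + k%:~R * s)| <= M * `|s|.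
  move=> dg hM k k2 k12.
  have := @taylor_le R 1 g c d M _ _ _ hM (in_cd _ k2) (in_cd _ k12).
  rewrite big_ord_recl big_ord0 /= fact0 divr1 expr0 mulr1 addr0 expr1.
  have -> : x + (k + 1)%:~R * s - (x + k%:~R * s) = s by rewrite intrD; ring.
  by apply=> -[|//] w _; apply: dg.
have mem2 (k : int) : k \in [:: -1; 0; 1] ->
    [/\ `|k| <= 2, `|k + 1| <= 2 & `|k - 1| <= 2].
  by rewrite !inE => /or3P[] /eqP ->.
apply: adjoint_stencil_le => //.
- move=> k hk; have [] : `|k| <= 2 /\ `|k + 1| <= 2.
    by move: hk; rewrite !inE => /or4P[] /eqP ->.
  exact: (lip phi M1 (fun w => dphi 0%N w isT) hM1 k).
- move=> k /mem2[k2 k12 k02].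
  have T (k' : int) (hk' : `|k'| <= 2) (r := (k' - k)%:~R * s) :
    `|phi (x + k'%:~R * s)
      - (phi (x + k%:~R * s) + derive1 phi (x + k%:~R * s) * r)|
      <= M2 * `|r| ^+ 2.
    have := taylor_le dphi hM2 (in_cd _ k2) (in_cd k' hk').
    rewrite !big_ord_recl big_ord0 /= !fact0 !divr1 expr0 mulr1 addr0 expr1.
    by rewrite (_ : x + _ - _ = r)// /r intrB; ring.
  have := T _ k12; have := T _ k02.
  rewrite [k + 1 - k]addrC [k - 1 - k]addrC !addKr.
  rewrite mulrN1z mulr1z mulN1r mul1r /= normrN mulrN !ler_norml.
  lra.
- move=> k /mem2[k2 k12 _]; rewrite distrC.
  exact: (lip p P1 (fun w => dp 0%N w isT) hP1 k k2 k12).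
pose c2 := derive1n 2 p x / 2`!%:R; pose c3 := derive1n 3 p x / 3`!%:R.
have T (k : int) (r := k%:~R * s) : `|k| <= 2 ->
  `|p (x + r) - (p x + derive1 p x * r + c2 * r ^+ 2 + c3 * r ^+ 3)|
    <= P4 * `|r| ^+ 4.
  move=> hk; have x0 : c <= x <= d by have := in_cd 0 isT; rewrite mul0r addr0.
  have := taylor_le dp hP4 x0 (in_cd k hk).
  rewrite !big_ord_recl big_ord0 /= fact0 !divr1 expr0 mulr1 addr0 expr1.
  by rewrite addrAC subrr add0r !addrA.
(* In the combination with coefficients 1/3, 1/2, -1, 1/6 the terms of degree 0, 2 and 3 cancel, and
   the linear one is [- s] times [derive1 p x]. *)
have := T (-1) isT; have := T 1 isT; have := T 2 isT.
clear T; move: c2 c3 => c2 c3.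
rewrite (_ : 2%:~R = 2)// mul0r addr0 mulrN1z mulr1z.
rewrite mulN1r mul1r /= normrN normrM normr_nat.
move: (derive1 p x : R) (p (x - s)) (p (x + 2 * s)) (p (x + s)) (p x)
  => c1 pm1 pp2 pp1 p0.
rewrite !ler_norml.
lra.
Qed.

(** * Regularity of the split fluxes along the solution *)

Lemma is_Ck_is_derive (R : realType) (k i : nat) (g : R -> R) (x : R) :
  is_Ck k g -> (i < k)%N -> is_derive x 1 (derive1n i g) (derive1n i.+1 g x).
Proof.
by move=> [dg _] ik; rewrite derive1nS derive1E; apply/derivableP/dg.
Qed.

Lemma is_Ck_continuous (R : realType) (k i : nat) (g : R -> R) :
  is_Ck k g -> (i <= k)%N -> continuous (derive1n i g).
Proof.
move=> gk; rewrite leq_eqVlt => /orP[/eqP ->|ik x]; first by case: gk.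
apply/differentiable_continuous/derivable1_diffP.
by have [] := is_Ck_is_derive x gk ik.
Qed.

Lemma is_Ck_le (R : realType) (k i : nat) (g : R -> R) :
  (i <= k)%N -> is_Ck k g -> is_Ck i g.
Proof.
move=> ik gk; split; last exact: is_Ck_continuous gk ik.
by move=> l x li; case: gk => dg _; apply: dg; apply: leq_trans ik.
Qed.

Lemma is_derive_flux_plus (R : realType) (f : R -> R) (alpha u : R) :
  derivable f u 1 ->
  is_derive u 1 (flux_plus f alpha) (2^-1 * (derive1 f u + alpha)).
Proof.
move=> df; have hf : is_derive u 1 f (derive1 f u).
  by rewrite derive1E; apply/derivableP.
apply: (is_derive_eq (is_deriveZ 2^-1
  (is_deriveD hf (is_deriveZ alpha (is_derive_id u 1))))).
by rewrite /GRing.scale /= mulr1.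
Qed.

(** Reduces the regularity and derivative of the minus flux to those of the plus flux. *)
Lemma flux_minusE (R : realType) (f : R -> R) (alpha : R) :
  flux_minus f alpha = flux_plus f (- alpha).
Proof. by apply/funext => u; rewrite /flux_minus /flux_plus mulNr. Qed.

Lemma flux_plus_comp_C2 (R : realType) (f y : R -> R) (alpha : R) :
  is_Ck 2 f -> is_Ck 2 y -> is_Ck 2 (flux_plus f alpha \o y).
Proof.
move=> f2 y2.
(* The first two derivatives, from the chain and product rules. *)
pose D1 x := 2^-1 * (derive1 f (y x) + alpha) * derive1 y x.
pose D2 x := 2^-1 * ((derive1n 2 f (y x) * derive1 y x) * derive1 y x
  + (derive1 f (y x) + alpha) * derive1n 2 y x).
have dy (x : R) : is_derive x 1 y (derive1 y x) :=
  is_Ck_is_derive x y2 (isT : (0 < 2)%N).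
have ddy (x : R) : is_derive x 1 (derive1 y) (derive1n 2 y x) :=
  is_Ck_is_derive x y2 (isT : (1 < 2)%N).
have h1 (x : R) : is_derive x 1 (flux_plus f alpha \o y) (D1 x).
  apply: is_derive1_comp; apply: is_derive_flux_plus.
  by case: f2 => df _; apply: (df 0%N).
have h2 (x : R) : is_derive x 1 D1 (D2 x).
  have dD (g y' : R -> R) (g' y'' : R) : is_derive (y x) 1 g g' ->
      is_derive x 1 y (y' x) -> is_derive x 1 y' y'' ->
      is_derive x 1 (fun x => 2^-1 * (g (y x) + alpha) * y' x)
        (2^-1 * ((g' * y' x) * y' x + (g (y x) + alpha) * y'')).
    move=> hg hy hy'.
    have hD : is_derive x 1 (fun x => 2^-1 * (g (y x) + alpha))
        (2^-1 * (g' * y' x + 0)) := is_deriveZ 2^-1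
      (is_deriveD (is_derive1_comp hg hy) (is_derive_cst alpha x 1)).
    by apply: (is_derive_eq (is_deriveM hD hy')); rewrite /GRing.scale /=; ring.
  have df := is_Ck_is_derive (y x) f2 (isT : (1 < 2)%N).
  exact: (dD _ _ _ _ df (dy x) (ddy x)).
have E1 : derive1 (flux_plus f alpha \o y) = D1.
  by apply/funext => x; rewrite derive1E derive_val.
have E2 : derive1 D1 = D2.
  by apply/funext => x; rewrite derive1E derive_val.
split.
  move=> [|[|//]] x _; first by have [] := h1 x.
  by rewrite derive1n1 E1; have [] := h2 x.
rewrite derive1nS derive1n1 E1 E2 => x.
have cy := @is_Ck_continuous _ _ 0 _ y2 isT.
have cy1 := @is_Ck_continuous _ _ 1 _ y2 isT.
have cy2 := @is_Ck_continuous _ _ 2 _ y2 isT.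
have cf1 := @is_Ck_continuous _ _ 1 _ f2 isT.
have cf2 := @is_Ck_continuous _ _ 2 _ f2 isT.
apply: cvgM; first exact: cvg_cst.
apply: cvgD; apply: cvgM => //.
- apply: cvgM; last exact: cy1.
  by apply: continuous_comp; [exact: cy|exact: cf2].
- exact: cy1.
- apply: cvgD; last exact: cvg_cst.
  by apply: continuous_comp; [exact: cy|exact: cf1].
- exact: cy2.
Qed.

(** * Assembly of the residual bound on the grid *)

Theorem theorem3p1 (R : realType) (f : R -> R) (T a b eps alpha : R)
    (u0 pT : R -> R) (y p : R -> R -> R) (t : R)
    (hT : 0 < T) (hab : a < b) (heps : 0 < eps)
    (hconv : convex_function [set: R^o] f)
    (hy : entropy_solution f T u0 y)
    (hsupp : forall s x, 0 <= s <= T -> ~~ (a <= x <= b) -> y s x = 0)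
    (hp : adjoint_solution f T y pT p)
    (halpha : is_max_speed f T y alpha)
    (ht : 0 < t <= T)
    (hf3 : is_Ck 3 f) (hy3 : is_Ck 3 (y t)) (hp4 : is_Ck 4 (p t)) :
  exists C : R, \forall N \near \oo, forall j : nat, (1 <= j <= N)%N ->
    `|adjoint_residual f alpha eps T a b y p N t j%:Z|
      <= C * mesh_size a b N ^+ 3.
Proof.
have f2 := is_Ck_le (isT : (2 <= 3)%N) hf3.
have y2 := is_Ck_le (isT : (2 <= 3)%N) hy3.
(* As the mesh size is at most [b - a], this segment contains the two neighbours on either side of
   every cell midpoint, for every [N]. *)
pose c := a - 2 * (b - a); pose d := b + 2 * (b - a).
have [C1 hC1] := adjoint_stencil_consistent c d heps
  (flux_plus_comp_C2 alpha f2 y2) hp4.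
have [C2 hC2] := adjoint_stencil_consistent c d heps
  (flux_plus_comp_C2 (- alpha) f2 y2) hp4.
have bnd (e : R) : exists B : R, forall x, c <= x <= d ->
    `|2^-1 * (derive1 f (y t x) + e)| <= B.
  apply: segment_bounded => x; apply: cvgM; first exact: cvg_cst.
  apply: cvgD; last exact: cvg_cst.
  have := @is_Ck_continuous _ _ 0 _ y2 isT x.
  move=> cy; apply: continuous_comp; first exact: cy.
  exact: (@is_Ck_continuous _ _ 1 _ f2 isT).
have [B1 hB1] := bnd alpha; have [B2 hB2] := bnd (- alpha).
(* For each wind direction: a bound on the derivative of the split flux times the stencil constant.
   The estimate holds for all [N], because [1 <= j <= N] excludes [N = 0]. *)
exists (B1 * C1 + B2 * C2); apply: nearW => N j /andP[j1 jN].
have N0 : 0 < N%:R :> R by rewrite ltr0n (leq_trans j1).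
pose h := mesh_size a b N; pose x := grid_point a b N j.
have h0 : 0 < h by rewrite divr_gt0 ?subr_gt0.
have hN : N%:R * h = b - a by rewrite /h /mesh_size mulrC divfK ?gt_eqF.
have gridD (k : int) : grid_point a b N (j%:Z + k) = x + k%:~R * h.
  by rewrite /x /grid_point intrD -/h; ring.
have j1' : 1 <= j%:R :> R by rewrite ler1n.
have jN' : j%:R <= N%:R :> R by rewrite ler_nat.
have xE : x = a + (j%:R - 1 / 2) * h by [].
have jh : 1 * h <= j%:R * h by rewrite ler_wpM2r // ltW.
have jNh : j%:R * h <= N%:R * h by rewrite ler_wpM2r // ltW.
have cx : c <= x - 2 * h by rewrite /c xE; lra.
have xd : x + 2 * h <= d by rewrite /d xE; lra.
have cxd : c <= x <= d by apply/andP; split; lra.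
(* The minus stencil runs backwards, with step [- h]. *)
have S1 := hC1 x h; have S2 := hC2 x (- h).
rewrite normrN (gtr0_norm h0) in S1 S2.
have {S1} := S1 cx xd; have {S2} := S2 cx xd.
pose Y k := y t (grid_point a b N k); pose P k := p t (grid_point a b N k).
rewrite /adjoint_residual /adjoint_rhs.
rewrite (adjoint_rhs_sumE alpha heps (Y := Y) P (j := j)); last first.
  by case: f2 => df _; apply: (df 0%N).
have -> : time_derivative T p t x = - (derive1 f (y t x) * derive1 (p t) x).
  by apply/eqP; rewrite -addr_eq0; apply/eqP; apply: adjoint_equation hp _ _ ht.
have -> : (fun k => P (j%:Z + k)) = fun k => p t (x + k%:~R * h).
  by apply/funext => k; rewrite /P gridD.
have -> : (fun k => P (j%:Z - k)) = fun k => p t (x + k%:~R * - h).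
  by apply/funext => k; rewrite /P gridD rmorphN mulrN mulNr.
have -> : (fun k => flux_plus f alpha (Y (j%:Z + k))) =
    fun k => (flux_plus f alpha \o y t) (x + k%:~R * h).
  by apply/funext => k; rewrite /Y gridD.
have -> : (fun k => flux_minus f alpha (Y (j%:Z - k))) =
    fun k => (flux_plus f (- alpha) \o y t) (x + k%:~R * - h).
  by apply/funext => k; rewrite flux_minusE /Y gridD rmorphN mulrN mulNr.
rewrite flux_minusE -/h -/x.
have dflux (e : R) :
    derive1 (flux_plus f e) (Y j) = 2^-1 * (derive1 f (y t x) + e).
  rewrite derive1E; apply: derive_val; apply: is_derive_flux_plus.
  by case: f2 => df _; apply: (df 0%N).
rewrite !dflux; move: (hB1 x cxd) (hB2 x cxd).
set SM := adjoint_stencil _ _ _; set SP := adjoint_stencil _ _ _.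
set gp := 2^-1 * _; set gm := 2^-1 * _ => hgp hgm hSM hSP.
(* The speed is the sum of the two split speeds, so the exact transport term divides between the two
   stencils. *)
have -> : derive1 f (y t x) = gp + gm by rewrite /gp /gm; field.
rewrite [X in `|X|](_ : _ = h^-1 * (gm * (SM + - h * derive1 (p t) x)
    - gp * (SP + h * derive1 (p t) x))); last first.
  by field; rewrite gt_eqF.
rewrite normrM gtr0_norm ?invr_gt0// mulrC ler_pdivrMr//.
rewrite (_ : _ * h = B2 * (C2 * h ^+ 4) + B1 * (C1 * h ^+ 4)); last by ring.
by rewrite (le_trans (ler_normB _ _))// lerD// normrM ler_pM.
Qed.
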